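(* Let $r,s,n$ be positive integers with $s\leq r$. Let $T$ be a tournament on $n$ vertices (not necessarily transitive), and suppose its edges are colored with $r$ colors so that no triangle (three vertices together with the three edges among them, regardless of orientation) has its three edges colored with three distinct colors. Then $T$ contains a directed path on at least $n^{s/r}$ vertices whose edges use at most $s$ colors.
   Context: A tournament is an orientation of a complete graph. A directed path is a sequence of distinct vertices $v_1,\dots,v_k$ such that each edge $v_jv_{j+1}$ is oriented from $v_j$ to $v_{j+1}$; its length is its number of vertices $k$. *)

(* Defs.v *)
From mathcomp Require Import all_boot all_order all_algebra.
From mathcomp Require Import all_classical all_reals all_analysis.

Set Implicit Arguments.
Unset Strict Implicit.
Unset Printing Implicit Defensive.

Definition tournament (V : finType) (e : rel V) : Prop :=
  irreflexive e /\ (forall x y : V, x != y -> e x y (+) e y x).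

(* [c x y] is the colour of the edge between distinct [x] and [y], whichever
   way it is oriented; the values on the diagonal are never used. *)
Definition edge_coloring (V : finType) (r : nat) (c : V -> V -> 'I_r) : Prop :=
  forall x y : V, c x y = c y x.

Definition no_rainbow_triangle (V : finType) (r : nat) (c : V -> V -> 'I_r) :
    Prop :=
  forall x y z : V, uniq [:: x; y; z] -> ~~ uniq [:: c x y; c y z; c x z].

Definition directed_path (V : finType) (e : rel V) (p : seq V) : bool :=
  sorted e p && uniq p.

Definition path_edges (V : finType) (p : seq V) : seq (V * V) :=
  zip p (behead p).

Definition path_colors (V : finType) (r : nat) (c : V -> V -> 'I_r)
    (p : seq V) : {set 'I_r} :=
  [set:: [seq c uv.1 uv.2 | uv <- path_edges p]].

(* Main.v *)
Require Import Defs.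
From mathcomp Require Import all_boot all_order all_algebra.
From mathcomp Require Import all_classical all_reals all_analysis.
From mathcomp Require Import fintype finset perm zify.

(** Let [k] be the largest size of a directed path with at most [s] colours. For
every set [S] of [s] colours, the Gallai-Roy theorem yields a proper colouring
of the graph of the edges with colour in [S] by [k] labels. It remains to see
that [n ^ 'C(r-1, s-1) <= k ^ 'C(r, s)], and this follows from the inequality
[n ^ 'C(r-1, s-1) <= \prod_S k_S], where [k_S] is the number of labels used for
[S]. For the induction, each vertex [v] carries a set [F S v] of labels for
every [S] and a weight [w v] with [w v ^ 'C(r-1, s-1) <= \prod_S #|F S v|].
By Gallai's theorem, a colouring without rainbow triangle that uses at least
three colours has a proper homogeneous set with at least two vertices, and this
set can be contracted; if at most two colours are used, the inequality is an
instance of Hölder's inequality. *)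

Set Implicit Arguments.
Unset Strict Implicit.
Unset Printing Implicit Defensive.
Import Order.TTheory GRing.Theory Num.Theory.

(** * The Gallai-Roy theorem *)

Section GallaiRoy.
Variables (V : finType) (e : rel V).

(** Every positive level is entered by an edge from the level just below. Edges inside a level are
    allowed: maximality will exclude them. *)
Definition levelled (f : V -> nat) : Prop :=
  forall v, 0 < f v -> exists2 u, e u v & f v = (f u).+1.

(** Descend from [v] one level at a time. The labels are recorded because their distinctness makes
    the vertices distinct. *)
Lemma levelled_path (f : V -> nat) (v : V) : levelled f ->
  exists2 p, sorted e (rcons p v) & map f (rcons p v) = iota 0 (f v).+1.
Proof.
move=> lf; move: {-1}(f v) (erefl (f v)) => k; elim: k v => [|k IHk] v fv.
  by exists [::]; rewrite //= fv.
have [u euv] : exists2 u, e u v & f v = (f u).+1 by apply: lf; rewrite fv.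
rewrite fv => -[/esym /IHk[p sp fp]]; exists (rcons p u).
  by case: p sp {fp} => [|x p] /=;
    rewrite ?andbT // !rcons_path last_rcons => ->.
by rewrite map_rcons fp fv -[k.+2]addn1 iotaD cats1.
Qed.

Lemma levelled_lt (f : V -> nat) (k : nat) (v : V) : levelled f ->
  (forall p, directed_path e p -> size p <= k) -> f v < k.
Proof.
move=> lf /= path_le; have [p sp fp] := levelled_path v lf.
rewrite -[(f v).+1](size_iota 0) -fp size_map path_le // /directed_path sp /=.
by apply: (@map_uniq _ _ f); rewrite fp iota_uniq.
Qed.

(* Maximise the sum of a levelled function: if an edge [x -> y] joined two
   vertices of the same level, raising by one every vertex reachable from [y]
   along edges that go up one level would give a larger levelled function. *)
Lemma gallai_roy (k : nat) : (forall p, directed_path e p -> size p <= k) ->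
  exists2 f : V -> nat, forall v, f v < k
                      & forall x y, x != y -> e x y -> f x != f y.
Proof.
move=> path_le.
pose P m := `[< exists2 f, levelled f & \sum_v f v = m >].
have exP : exists m, P m.
  by exists (\sum_(v : V) 0); apply/asboolP; exists (fun=> 0).
have ubP m : P m -> m <= \sum_(v : V) k.
  case/asboolP => f lf <-; apply: leq_sum => v _.
  exact/ltnW/levelled_lt.
case: (ex_maxnP exP ubP) => _ /asboolP[f lf <-] f_max.
exists f => [v|x y neq_xy exy]; first exact: levelled_lt.
apply/eqP => fxy; pose D := [rel u v | e u v && (f v == (f u).+1)].
have fD q u : path D u q -> f (last u q) = f u + size q.
  elim: q u => [|v q IHq] u /=; first by rewrite addn0.
  by case/andP => /andP[_ /eqP fv] /IHq ->; rewrite fv addSnnS.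
(* Each [D]-edge raises [f] by one, so with [f x = f y] only the empty walk from [y] could end at
   [x]. *)
have Nyx : connect D y x = false.
  apply/negP => /connectP[q /fD + xq]; rewrite -xq fxy.
  case: q xq => [yx|? ? _] /=; first by rewrite yx eqxx in neq_xy.
  by lia.
pose f' z := f z + connect D y z.
have lf' : levelled f'.
  (* Below [y] lies the unraised [x]; any other raised vertex has a raised predecessor on its
     [D]-path; below an unraised [v] lies an unraised [u], since otherwise [v] would be reached
     through [u]. *)
  move=> v; rewrite /f'; case: (boolP (connect D y v)) => [/connectP[q]|Nyv].
    case/lastP: q => [_ -> _|q z].
      by exists x => //; rewrite Nyx fxy addn0 addn1.
    rewrite rcons_path last_rcons => /andP[yq /andP[ez /eqP fz]] -> _.
    exists (last y q) => //; rewrite fz addSn.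
    by suff -> : connect D y (last y q) by []; apply/connectP; exists q.
  rewrite addn0 => /lf[u euv fv]; exists u => //; rewrite fv.
  suff -> : connect D y u = false by rewrite addn0.
  apply: contraNF Nyv => yu; apply: connect_trans yu (connect1 _).
  by rewrite /= euv fv eqxx.
have /f_max : P (\sum_v f' v) by apply/asboolP; exists f'.
by rewrite big_split /= (bigD1 y) ?(bigD1 (P := predT) y) //= connect0; lia.
Qed.

End GallaiRoy.

(** * Gallai's theorem on colourings without rainbow triangle *)

Lemma third_element (T : finType) (A : {set T}) (a b : T) :
  2 < #|A| -> exists x, [/\ x \in A, x != a & x != b].
Proof.
move=> A2; have : 0 < #|A :\ a :\ b|.
  have := cardsD1 a A; have := cardsD1 b (A :\ a).
  by do 2!case: (_ \in _) => /=; lia.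
by case/card_gt0P => x; rewrite !inE => /and3P[]; exists x.
Qed.

Section GallaiColoring.
Variables (V : finType) (r : nat) (c : V -> V -> 'I_r).
Hypotheses (c_sym : edge_coloring c) (c_gallai : no_rainbow_triangle c).

Lemma gallai_triangle (x y z : V) : x != y -> y != z -> x != z ->
  c x y != c y z -> c y z != c x z -> c x y = c x z.
Proof.
move=> xy yz xz c1 c2; have := @c_gallai x y z.
rewrite /= !inE !negb_or xy yz xz c1 c2 /= andbT.
by move/(_ isT); rewrite negbK => /eqP.
Qed.

Definition color_adj (W : {set V}) (i : 'I_r) (x y : V) : bool :=
  [&& x \in W, y \in W & c x y == i].
Arguments color_adj W i x y /.

Definition color_comp (W : {set V}) (i : 'I_r) (x : V) : {set V} :=
  [set y | connect (color_adj W i) x y].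

Definition colors_in (W : {set V}) : {set 'I_r} :=
  [set i | [exists x in W, exists y in W, (x != y) && (c x y == i)]].

Lemma colors_inP (W : {set V}) (i : 'I_r) :
  reflect (exists x y, [/\ x \in W, y \in W, x != y & c x y = i])
          (i \in colors_in W).
Proof.
rewrite inE; apply: (iffP exists_inP) => [[x xW /exists_inP[y yW]]|].
  by case/andP => xy /eqP cxy; exists x, y.
case=> x [y [xW yW xy /eqP cxy]]; exists x => //.
by apply/exists_inP; exists y; rewrite ?xy.
Qed.

Lemma mem_colors_in (W : {set V}) (x y : V) :
  x \in W -> y \in W -> x != y -> c x y \in colors_in W.
Proof. by move=> xW yW xy; apply/colors_inP; exists x, y. Qed.

Lemma color_connect_sym (W : {set V}) (i : 'I_r) :
  connect_sym (color_adj W i).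
Proof.
by apply: sym_connect_sym => x y; rewrite /= c_sym andbCA.
Qed.

Lemma color_comp_sub (W : {set V}) (i : 'I_r) (x : V) :
  x \in W -> color_comp W i x \subset W.
Proof.
move=> xW; apply/subsetP => y; rewrite inE => xy.
rewrite -(closed_connect _ xy) // => u v /and3P[uW vW _].
by rewrite uW vW.
Qed.

(** Along an [i]-edge [u v] of the component, neither [y u] nor [y v] has colour [i], so the
    triangle [y u v] forces [c y u = c y v]; connectivity spreads this equality. *)
Lemma color_comp_homogeneous (W : {set V}) (i : 'I_r) (x y x1 x2 : V) :
  y \in W -> y \notin color_comp W i x ->
  x1 \in color_comp W i x -> x2 \in color_comp W i x -> c y x1 = c y x2.
Proof.
move=> yW; rewrite inE => Nxy.
suff main z : z \in color_comp W i x -> c y z = c y x by move=> /main-> /main->.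
have csym := @color_connect_sym W i.
rewrite inE => xz.
pose a := [pred u | connect (color_adj W i) x u && (c y u == c y x)].
have cl_a : fingraph.closed (color_adj W i) a.
  move=> u v auv; have uv := connect1 auv.
  rewrite !inE -(same_connect_r csym uv).
  case: (boolP (connect _ x u)) => //= xu; congr (_ == _).
  have xv := connect_trans xu uv.
  case/and3P: auv => uW vW /eqP cuv.
  have [->//|nuv] := eqVneq u v.
  have Nadj t : t \in W -> connect (color_adj W i) x t ->
      (c y t != i) /\ (y != t).
    move=> tW xt; split; last by apply: contraNneq Nxy => ->.
    apply: contraNneq Nxy => cyt; apply: connect_trans xt (connect1 _).
    by rewrite /= tW yW c_sym cyt eqxx.
  have [cyu nyu] := Nadj u uW xu; have [cyv nyv] := Nadj v vW xv.
  by apply: gallai_triangle; rewrite ?cuv // eq_sym.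
have := closed_connect cl_a xz.
by rewrite !inE connect0 eqxx xz /= => /esym/eqP.
Qed.

(** Otherwise [A] would be closed under [i]-edges and contain [b]. *)
Lemma color_cut (W A : {set V}) (i : 'I_r) (a b : V) :
  (forall x y, x \in W -> y \in W -> connect (color_adj W i) x y) ->
  A \subset W -> a \in A -> b \in W -> b \notin A ->
  exists u v, [/\ u \in A, v \in W, v \notin A & c u v = i].
Proof.
move=> conW /subsetP AW aA bW bA.
have : ~~ [forall u in A, forall v in W, (c u v == i) ==> (v \in A)].
  apply: contra bA => /forall_inP/= clA.
  suff cl : fingraph.closed (color_adj W i) A.
    by rewrite -(closed_connect cl (conW a b (AW a aA) bW)).
  move=> u v /and3P[uW vW cuv]; apply/idP/idP => [uA|vA].
    by have /forall_inP/(_ v vW)/implyP := clA u uA; apply.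
  by have /forall_inP/(_ u uW)/implyP := clA v vA; apply; rewrite c_sym.
rewrite negb_forall_in => /exists_inP[u uA].
rewrite negb_forall_in => /exists_inP[v vW].
by rewrite negb_imply => /andP[/eqP cuv vA]; exists u, v.
Qed.

(* Remove a vertex [v]. If all colours are connected on [W], each of them occurs
   at [v]; if [i] is disconnected on [W :\ v], then [v] has an [i]-edge to every
   [i]-component, and this leaves room for only one further colour at [v]. *)
Lemma disconnected_color (W : {set V}) : 2 < #|colors_in W| ->
  exists i x y, [/\ i \in colors_in W, x \in W, y \in W
                  & ~~ connect (color_adj W i) x y].
Proof.
have [m] := ubnP #|W|; elim: m W => // m IHm W Wm cW.
case: (boolP [exists i in colors_in W, exists x in W, exists y in W,
                ~~ connect (color_adj W i) x y]).
  case/exists_inP => i iW /exists_inP[x xW] /exists_inP[y yW Nxy].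
  by exists i, x, y.
rewrite negb_exists_in => /forall_inP conW; exfalso.
have {}conW i : i \in colors_in W ->
    forall x y, x \in W -> y \in W -> connect (color_adj W i) x y.
  move=> /conW + x y xW yW; rewrite negb_exists_in => /forall_inP/(_ x xW).
  by rewrite negb_exists_in => /forall_inP/(_ y yW); rewrite negbK.
have [i0 i0W] : exists i, i \in colors_in W.
  by apply/card_gt0P; apply: leq_trans cW.
have [v [v' [vW v'W vv' _]]] := colors_inP _ _ i0W.
have star i : i \in colors_in W -> exists u, [/\ u \in W, u != v & c v u = i].
  move=> iW; have [||//||a [b [/set1P-> bW]]] :=
    @color_cut W [set v] i v v' (conW i iW).
  - by rewrite sub1set.
  - by rewrite set11.
  - by rewrite inE eq_sym.
  - by rewrite inE => bv cvb; exists b.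
pose W' := W :\ v.
have W'W z : z \in W' -> z \in W by case/setD1P.
have cW'W i : i \in colors_in W' -> i \in colors_in W.
  case/colors_inP => x [y [/W'W xW /W'W yW xy cxy]].
  by apply/colors_inP; exists x, y.
have [cW'|cW'] := ltnP 2 #|colors_in W'|; last first.
  (* A colour [l] lost with [v] occurs only at [v]. Since [l] is connected on [W], all edges at [v]
     have colour [l], against [star] for another colour. *)
  have [l lW lW'] : exists2 l, l \in colors_in W & l \notin colors_in W'.
    have /subsetPn : ~~ (colors_in W \subset colors_in W').
      by apply/negP => /subset_leq_card; lia.
    by case=> l; exists l.
  have all_l x : x \in W -> x != v -> c v x = l.
    move=> xW xv; have [||//||a [b [/set1P-> bW bx cxb]]] :=
      @color_cut W [set x] l x v (conW l lW).
    - by rewrite sub1set.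
    - by rewrite set11.
    - by rewrite inE eq_sym.
    - rewrite inE in bx; have [bv|bv] := eqVneq b v; first by rewrite -bv c_sym.
      case/negP: lW'; apply/colors_inP; exists x, b.
      by rewrite !inE xW bW xv bv eq_sym bx.
  have [j [jW jl _]] := third_element l l cW.
  have [u [uW uv cvu]] := star j jW.
  by rewrite -cvu all_l ?eqxx in jl.
have [] := IHm W' _ cW'.
  by have := cardsD1 v W; rewrite vW /W' => Wv; lia.
move=> i [a [b [iW' aW' bW' Nab]]].
have iW := cW'W i iW'.
have inter z : z \in W' -> exists2 x, x \in color_comp W' i z & c v x = i.
  move=> zW'.
  have CW' := color_comp_sub i zW'.
  have [||||x [y [xC yW yC cxy]]] :=
    @color_cut W (color_comp W' i z) i z v (conW i iW).
  - by apply/subsetP => t /(subsetP CW')/W'W.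
  - by rewrite inE connect0.
  - by [].
  - by apply/negP => /(subsetP CW'); rewrite !inE eqxx.
  - exists x => //; have [<-|yv] := eqVneq y v; first by rewrite c_sym.
    case/negP: yC; move: (xC); rewrite !inE => xz.
    apply: connect_trans xz (connect1 _).
    by rewrite /= (subsetP CW' _ xC) cxy eqxx !inE yW yv.
have cv x y : x \in W' -> y \in W' -> x != y -> c v x = i -> c v y != i ->
    c x y != i -> c x y = c v y.
  move=> /setD1P[xv _] /setD1P[yv _] xy cvx cvy cxy.
  have yx : y != x by rewrite eq_sym.
  rewrite (c_sym v) (c_sym x); apply: gallai_triangle => //.
    by rewrite (c_sym x v) cvx c_sym.
  by rewrite (c_sym x) (c_sym y) cvx eq_sym.
have cneq x y :
    x \in W' -> y \in W' -> y \notin color_comp W' i x -> c x y != i.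
  move=> xW' yW'; rewrite inE; apply: contraNneq => cxy; apply: connect1.
  by rewrite /= xW' yW' cxy eqxx.
have [d [dW di _]] := third_element i i cW.
have [d' [d'W d'i d'd]] := third_element i d cW.
have [w [wW wv cvw]] := star d dW; have [w' [w'W w'v cvw']] := star d' d'W.
have wW' : w \in W' by rewrite !inE wv.
have w'W' : w' \in W' by rewrite !inE w'v.
have csym := @color_connect_sym W' i.
have self z : z \in color_comp W' i z by rewrite inE connect0.
have compC x y : (y \in color_comp W' i x) = (x \in color_comp W' i y).
  by rewrite !inE csym.
have [z zW' zC] : exists2 z, z \in W' & z \notin color_comp W' i w.
  case: (boolP (a \in color_comp W' i w)) => aw; last by exists a.
  exists b => //; apply: contra Nab; move: aw; rewrite !inE => aw wb.
  by apply: connect_trans wb; rewrite csym.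
(* If [w] and [w'] share a component, an [i]-neighbour [u] of [v] in another component sees [w] in
   colour [d] and [w'] in colour [d'], against homogeneity. *)
case: (boolP (w' \in color_comp W' i w)) => w'C.
  have [u uC cvu] := inter z zW'.
  have uW' := subsetP (color_comp_sub i zW') u uC.
  have uNw : u \notin color_comp W' i w.
    apply: contra zC; rewrite !inE => wu; apply: connect_trans wu _.
    by move: uC; rewrite inE csym.
  have cu := color_comp_homogeneous uW' uNw (self w) w'C.
  have nuw t : t \in color_comp W' i w -> (u != t) /\ (c u t != i).
    move=> tC; split; first by apply: contraNneq uNw => ->.
    rewrite c_sym; apply: cneq => //.
      exact: subsetP (color_comp_sub i wW') t tC.
    apply: contra uNw; rewrite !inE in tC *; exact: connect_trans.
  have [uw1 uw2] := nuw _ (self w); have [uw3 uw4] := nuw _ w'C.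
  have c1 : c u w = d by rewrite -cvw; apply: cv; rewrite ?cvw.
  have c2 : c u w' = d' by rewrite -cvw'; apply: cv; rewrite ?cvw'.
  by rewrite -c1 cu c2 eqxx in d'd.
(* In different components, [i]-neighbours [x], [x'] of [v] next to [w], [w'] give the edge [w w']
   both colours: [d'] through [x w'] and [d] through [x' w]. *)
have [x xC cvx] := inter w wW'.
have [x' x'C cvx'] := inter w' w'W'.
have xW' := subsetP (color_comp_sub i wW') x xC.
have x'W' := subsetP (color_comp_sub i w'W') x' x'C.
have wC' : w \notin color_comp W' i w' by rewrite compC.
have e1 := color_comp_homogeneous w'W' w'C (self w) xC.
have e2 := color_comp_homogeneous wW' wC' (self w') x'C.
have w'x : w' \notin color_comp W' i x.
  apply: contra w'C; rewrite !inE in xC *; exact: connect_trans.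
have wx' : w \notin color_comp W' i x'.
  apply: contra wC'; rewrite !inE in x'C *; exact: connect_trans.
have c1 : c x w' = d'.
  rewrite -cvw'; apply: cv; rewrite ?cvw' ?cneq //.
  by apply: contraNneq w'x => ->.
have c2 : c x' w = d.
  rewrite -cvw; apply: cv; rewrite ?cvw ?cneq //.
  by apply: contraNneq wx' => ->.
by case/eqP: d'd; rewrite -c1 -c2 c_sym -e1 c_sym e2 c_sym.
Qed.

(** [H] is a component of a disconnected colour [i] around an endpoint of an [i]-edge: the edge
    gives two vertices, disconnectedness makes [H] proper. *)
Lemma gallai_homogeneous (W : {set V}) : 2 < #|colors_in W| ->
  exists H : {set V}, [/\ H \proper W, 1 < #|H|
    & forall y x1 x2, y \in W -> y \notin H -> x1 \in H -> x2 \in H ->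
        c y x1 = c y x2].
Proof.
case/disconnected_color => i [a [b [/colors_inP[x [y]]]]].
case=> xW yW xy cxy aW bW Nab.
have xx : x \in color_comp W i x by rewrite inE connect0.
exists (color_comp W i x); split; last first.
- by move=> ? ? ?; apply: color_comp_homogeneous.
- rewrite (cardD1 x) (cardD1 y) xx !inE /= eq_sym xy.
  by rewrite (connect1 (e := color_adj W i)) // /= xW yW cxy eqxx.
- rewrite properE color_comp_sub //=; apply: contra Nab => /subsetP WC.
  have:= WC a aW; have:= WC b bW; rewrite !inE color_connect_sym => bx xa.
  by rewrite color_connect_sym; apply: connect_trans bx xa.
Qed.

End GallaiColoring.

(** * Hölder's inequality for natural numbers *)

(* Hölder's inequality without roots: AM-GM applied, for each [v], to the
   quotients of [x j v] by the sums of [x j]. *)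
Lemma prod_sum_ge_exp (R : realType) (I V : finType) (J : {set I}) (W : {set V})
    (M : nat) (x : I -> V -> nat) (w : V -> nat) : 0 < #|J| ->
  (forall v, v \in W -> w v ^ #|J| <= M * \prod_(j in J) x j v) ->
  (\sum_(v in W) w v) ^ #|J| <= M * \prod_(j in J) \sum_(v in W) x j v.
Proof.
set N := #|J|; move=> N_gt0 w_le; set X := fun j => \sum_(v in W) x j v.
case: (posnP (M * \prod_(j in J) X j)) => [P0|P_gt0].
  suff w0 v : v \in W -> w v = 0 by rewrite big1 // exp0n.
  move=> vW; suff : w v ^ N == 0 by rewrite expn_eq0 => /andP[/eqP].
  rewrite -leqn0 -P0 (leq_trans (w_le v vW)) // leq_mul2l.
  rewrite leq_prod ?orbT // => j _.
  by rewrite /X (bigD1 v) //= leq_addr.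
have X_gt0 j : j \in J -> 0 < X j.
  move=> jJ; move: P_gt0; rewrite (bigD1 j) //= !muln_gt0.
  by case/and3P.
pose P : R := ((M * \prod_(j in J) X j)%N%:R)%R.
pose rho : R := (P `^ N%:R^-1)%R.
have NR0 : (N%:R != 0 :> R)%R by rewrite pnatr_eq0 -lt0n.
have P_pos : (0 < P)%R by rewrite ltr0n.
have rho_gt0 : (0 < rho)%R by rewrite powR_gt0.
have rhoN : (rho ^+ N = P)%R.
  by rewrite -powR_mulrn ?ltW // -powRrM mulVf // powRr1 // ltW.
(* [rho] is the [N]-th root of the right-hand side. Summed over [v], each family of quotients on the
   right contributes 1, so the average is 1. *)
have key v : v \in W ->
    ((w v)%:R / rho <= (\sum_(j in J) (x j v)%:R / (X j)%:R) / N%:R :> R)%R.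
  have E0 j : j \in J -> (0 <= (x j v)%:R / (X j)%:R :> R)%R.
    by rewrite divr_ge0.
  move=> vW; rewrite -(ler_pXn2r N_gt0); first last.
  - by rewrite nnegrE divr_ge0 ?sumr_ge0.
  - by rewrite nnegrE divr_ge0 // ltW.
  have := leif_AGM E0; rewrite -/N => -[+ _].
  apply: le_trans.
  rewrite expr_div_n rhoN ler_pdivrMr // prodf_div -natrX.
  rewrite /P natrM !natr_prod mulrCA [X in (_ * X)%R]divfK.
    by rewrite -natr_prod -natrM ler_nat w_le.
  by rewrite prodf_seq_neq0; apply/allP => j _; apply/implyP => /X_gt0;
     rewrite pnatr_eq0 -lt0n.
rewrite -(ler_nat R) -/P natrX -rhoN ler_pXn2r ?nnegrE ?(ltW rho_gt0) //.
rewrite -[leRHS]mul1r -ler_pdivrMr // natr_sum mulr_suml.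
apply: le_trans (ler_sum _ (fun v => @key v)) _.
rewrite -mulr_suml exchange_big /= ler_pdivrMr ?ltr0n // mul1r.
rewrite (eq_bigr (fun=> 1%R)) => [|j jJ]; first by rewrite sumr_const.
by rewrite -mulr_suml -natr_sum divff // pnatr_eq0 -lt0n X_gt0.
Qed.

Lemma sum_card_disjoint (I T : finType) (W : {set I}) (F : I -> {set T}) :
  {in W &, forall x y, x != y -> [disjoint F x & F y]} ->
  \sum_(v in W) #|F v| <= #|\bigcup_(v in W) F v|.
Proof.
move=> disF; rewrite -[leqRHS]sum1_card [leqRHS]big_mkcond /=.
rewrite (eq_bigr (fun v => \sum_t (t \in F v : nat))); last first.
  by move=> v _; rewrite -sum1_card big_mkcond;
    apply: eq_bigr => t _; case: ifP.
rewrite exchange_big /=; apply: leq_sum => t _.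
case: bigcupP => [[v vW tv]|NtW].
  rewrite (bigD1 v) //= tv big1 // => u /andP[uW uv]; apply/eqP; rewrite eqb0.
  by rewrite (disjointFl (disF _ _ uW vW uv) tv).
rewrite big1 // => v vW; apply/eqP; rewrite eqb0.
by apply/negP => tv; apply: NtW; exists v.
Qed.

(** * Sets of [s] colours and the exchange of two colours *)

Lemma card_draws_mem (T : finType) (a : T) (s : nat) : 0 < s ->
  #|[set S : {set T} | (#|S| == s) && (a \in S)]| = 'C(#|T|.-1, s.-1).
Proof.
move=> s_gt0; rewrite -(cardsC1 a) -(cards_draws [set~ a] s.-1).
rewrite -[RHS](@card_in_imset _ _ (fun S => a |: S)).
  apply: eq_card => S; apply/idP/imsetP => [|[A]].
    rewrite inE => /andP[/eqP cS aS].
    exists (S :\ a); last by rewrite setD1K.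
    have := cardsD1 a S; rewrite aS cS inE => ->.
    by rewrite eqxx andbT; apply/subsetP => z; rewrite !inE => /andP[].
  rewrite inE => /andP[Aa /eqP cA] ->; rewrite inE setU11 cardsU1 cA.
  suff -> : a \notin A by rewrite add1n prednK ?eqxx.
  by apply/negP => /(subsetP Aa); rewrite !inE eqxx.
move=> A B; rewrite !inE => /andP[Aa _] /andP[Ba _] eqAB.
have aA : a \notin A by apply/negP => /(subsetP Aa); rewrite !inE eqxx.
have aB : a \notin B by apply/negP => /(subsetP Ba); rewrite !inE eqxx.
by rewrite -(setU1K aA) eqAB setU1K.
Qed.

(** Exchanging both colours, instead of replacing [a] by [b], gives an involution, along which
    products over [S] can be reindexed. *)
Definition swap_color (T : finType) (a b : T) (S : {set T}) : {set T} :=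
  [set tperm a b i | i in S].

Lemma swap_colorK (T : finType) (a b : T) : involutive (swap_color a b).
Proof.
move=> S; rewrite /swap_color -imset_comp (eq_imset (g := id)) ?imset_id //.
by move=> i /=; rewrite tpermK.
Qed.

Lemma mem_swap_color (T : finType) (a b i : T) (S : {set T}) :
  (i \in swap_color a b S) = (tperm a b i \in S).
Proof. by rewrite -{1}(tpermK a b i) mem_imset //; apply: perm_inj. Qed.

(* [a = b] is allowed: it covers colourings by one colour, and [r = 1]. *)
Lemma prod_draws_swap (T : finType) (a b : T) (s : nat) (g : {set T} -> nat) :
  \prod_(S : {set T} | #|S| == s) g S =
  (\prod_(S : {set T} | [&& #|S| == s, a \notin S & b \notin S]) g S) *
  \prod_(S in [set S : {set T} | (#|S| == s) && (a \in S)])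
     (g S * (if b \in S then 1 else g (swap_color a b S))).
Proof.
rewrite (bigID (fun S : {set T} => a \in S)) /= mulnC.
rewrite (bigID (fun S : {set T} => b \in S)) /= -mulnA mulnCA; congr (_ * _).
  by apply: eq_bigl => S; rewrite andbA.
rewrite big_split /= mulnC; congr (_ * _).
  by apply: eq_bigl => S; rewrite inE.
rewrite (reindex_inj (inv_inj (swap_colorK a b))) big_mkcond [RHS]big_mkcond /=.
apply: eq_bigr => S _; rewrite !mem_swap_color tpermL tpermR inE.
rewrite card_imset; last exact: perm_inj.
by case: (#|S| == s) (a \in S) (b \in S) => [] [] [].
Qed.

(** * The product inequality for label sets *)

Section BlockBound.
Variables (V T : finType) (r s : nat) (c : V -> V -> 'I_r).
Hypotheses (c_sym : edge_coloring c) (c_gallai : no_rainbow_triangle c).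
Hypotheses (r_gt0 : 0 < r) (s_gt0 : 0 < s) (s_le_r : s <= r).

Let N := 'C(r.-1, s.-1).

Let N_gt0 : 0 < N. Proof. by rewrite bin_gt0; lia. Qed.

(** With one-element label sets, [F S] is a proper colouring of the graph of edges with colour in
    [S]. Larger sets arise when vertices are merged. *)
Definition multicoloring (W : {set V}) (F : {set 'I_r} -> V -> {set T}) :
    Prop :=
  forall (S : {set 'I_r}) x y, x \in W -> y \in W -> x != y -> c x y \in S ->
    [disjoint F S x & F S y].

(* If [S] contains [a] and [b], the sets [F S v] are disjoint; if it contains
   [a] only, the products of [F S v] with [F S' v] are disjoint, where [S'] is
   [S] with [a] replaced by [b]. Hölder's inequality is applied to these
   ['C(r.-1, s.-1)] families; the [S] without [a] and [b] give the constant. *)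
Lemma two_color_bound (R : realType) (W : {set V}) (a b : 'I_r)
    (F : {set 'I_r} -> V -> {set T}) (w : V -> nat) :
  (forall x y, x \in W -> y \in W -> x != y -> (c x y == a) || (c x y == b)) ->
  multicoloring W F ->
  (forall v, v \in W ->
     w v ^ N <= \prod_(S : {set 'I_r} | #|S| == s) #|F S v|) ->
  (\sum_(v in W) w v) ^ N <=
    \prod_(S : {set 'I_r} | #|S| == s) #|\bigcup_(v in W) F S v|.
Proof.
move=> c_ab F_ok w_le; set J := [set S : {set 'I_r} | (#|S| == s) && (a \in S)].
have cJ : #|J| = N by rewrite card_draws_mem // card_ord.
rewrite (prod_draws_swap a b) -/J.
set U := fun S => \bigcup_(v in W) F S v.
have FU S v : v \in W -> #|F S v| <= #|U S|.
  by move=> vW; apply/subset_leq_card/bigcup_sup.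
set M := \prod_(S | _) #|U S|.
pose x S v := #|F S v| * (if b \in S then 1 else #|F (swap_color a b S) v|).
apply: leq_trans (_ : _ <= M * \prod_(S in J) \sum_(v in W) x S v) _.
  rewrite -cJ; apply: (@prod_sum_ge_exp R) => [|v vW]; first by rewrite cJ.
  rewrite cJ; apply: leq_trans (w_le v vW) _.
  rewrite (prod_draws_swap a b) leq_mul2r; apply/orP; right.
  by apply: leq_prod => S _; apply: FU.
rewrite leq_mul2l; apply/orP; right; apply: leq_prod => S.
rewrite inE /x => /andP[_ aS]; case: (boolP (b \in S)) => bS.
  rewrite muln1; under eq_bigr do rewrite muln1.
  apply: sum_card_disjoint => y z yW zW yz; apply: F_ok => //.
  by case/orP: (c_ab y z yW zW yz) => /eqP->.
under eq_bigr do rewrite -cardsX.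
apply: leq_trans (sum_card_disjoint _) _ => [y z yW zW yz|].
  rewrite -setI_eq0; apply/eqP/setP => -[t t']; rewrite !inE /=.
  case/orP: (c_ab y z yW zW yz) => /eqP cyz.
    have dis : [disjoint F S y & F S z] by apply: F_ok; rewrite ?cyz.
    by case: (boolP (t \in F S y)) => // ty;
      rewrite (disjointFr dis ty) /= andbF.
  have dis : [disjoint F (swap_color a b S) y & F (swap_color a b S) z].
    by apply: F_ok; rewrite ?cyz ?mem_swap_color ?tpermR.
  case: (boolP (t' \in F (swap_color a b S) y)) => ty; last by rewrite andbF.
  by rewrite (disjointFr dis ty) /= !andbF.
rewrite -cardsX subset_leq_card //; apply/bigcupsP => v vW.
by apply: setXS; apply: bigcup_sup.
Qed.

(* A homogeneous set [H] is contracted to one of its vertices [h], which gets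
   all the labels and all the weight of [H]. *)
Lemma block_bound (R : realType) (W : {set V})
    (F : {set 'I_r} -> V -> {set T}) (w : V -> nat) :
  multicoloring W F ->
  (forall v, v \in W ->
     w v ^ N <= \prod_(S : {set 'I_r} | #|S| == s) #|F S v|) ->
  (\sum_(v in W) w v) ^ N <=
    \prod_(S : {set 'I_r} | #|S| == s) #|\bigcup_(v in W) F S v|.
Proof.
have [m] := ubnP #|W|; elim: m W F w => // m IHm W F w Wm F_ok w_le.
have [cW|cW] := ltnP 2 #|colors_in c W|; last first.
  have [a [b abW]] : exists a b, colors_in c W \subset [set a; b].
    have [W0|[a aW]] := set_0Vmem (colors_in c W).
      by exists (Ordinal r_gt0), (Ordinal r_gt0); rewrite W0 sub0set.
    have [W0|[b bW]] := set_0Vmem (colors_in c W :\ a).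
      by exists a, a; rewrite -subDset W0 sub0set.
    exists a, b; rewrite -subDset.
    rewrite (_ : _ :\ a = [set b]) //; apply/esym/eqP.
    rewrite eqEcard sub1set bW cards1.
    by have := cardsD1 a (colors_in c W); rewrite aW; lia.
  apply: (@two_color_bound R W a b) => // x y xW yW xy.
  by have /(subsetP abW) := mem_colors_in c xW yW xy; rewrite !inE.
have [H [HW H_gt1 homH]] := gallai_homogeneous c_sym c_gallai cW.
have /subsetP sHW := proper_sub HW; have ltHW := proper_card HW.
have [h hH] : exists h, h \in H by apply/card_gt0P/ltnW.
have IH_H : (\sum_(v in H) w v) ^ N <=
    \prod_(S : {set 'I_r} | #|S| == s) #|\bigcup_(v in H) F S v|.
  apply: IHm => [|S x y xH yH|v vH]; first exact: leq_trans ltHW _.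
  - by apply: F_ok; apply: sHW.
  - by apply/w_le/sHW.
pose W' := h |: (W :\: H).
pose F' S v := if v == h then \bigcup_(u in H) F S u else F S v.
pose w' v := if v == h then \sum_(u in H) w u else w v.
have hD : h \notin W :\: H by rewrite inE hH.
have notH v : v \in W :\: H -> (v == h) = false.
  by move=> vD; apply: contraNF hD => /eqP <-.
have sum_w : \sum_(v in W') w' v = \sum_(v in W) w v.
  rewrite big_setU1 //= {1}/w' eqxx [RHS](big_setID H) /=; congr (_ + _).
    by apply: eq_bigl => v; rewrite inE;
      case: (boolP (v \in H)) => [/sHW->|]; rewrite ?andbF.
  by apply: eq_bigr => v vD; rewrite /w' notH.
have cup_F S : \bigcup_(v in W') F' S v = \bigcup_(v in W) F S v.
  rewrite big_setU1 //= {1}/F' eqxx [RHS](big_setID H) /=; congr (_ :|: _).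
    by apply: eq_bigl => v; rewrite inE;
      case: (boolP (v \in H)) => [/sHW->|]; rewrite ?andbF.
  by apply: eq_bigr => v vD; rewrite /F' notH.
rewrite -sum_w; under [leqRHS]eq_bigr do rewrite -cup_F.
(* By homogeneity [y] sees all of [H] in the colour [c h y], so its labels avoid those of every [u]
   in [H]. *)
have disH (S : {set 'I_r}) y : y \in W :\: H -> c h y \in S ->
    [disjoint F S y & \bigcup_(u in H) F S u].
  rewrite inE => /andP[yH yW] chy; apply: bigcup_disjoint => u uH.
  apply: F_ok => //; first exact: sHW.
    by apply: contraNneq yH => ->.
  by rewrite (homH y u h) // c_sym.
apply: IHm.
(* [W'] has [#|W| - #|H| + 1] vertices, fewer than [W] because [1 < #|H|]. *)
- rewrite cardsU1 hD; have := cardsID H W.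
  rewrite (setIidPr _); last by apply/subsetP.
  by move=> WH; lia.
- move=> S x y; rewrite /F' !in_setU1.
  have [->|xh] := eqVneq x h; have [->|yh] := eqVneq y h; rewrite ?eqxx //=.
  + by move=> _ yD _ chy; rewrite disjoint_sym disH.
  + by move=> xD _ _ cxh; rewrite disH // c_sym.
  + by move=> /setDP[xW _] /setDP[yW _]; apply: F_ok.
- move=> v; rewrite /w' /F' in_setU1; case: eqP => //= _.
  by move=> /setDP[vW _]; apply: w_le.
Qed.

End BlockBound.

(** * From labels to the path *)

Lemma path_colors_sub (V : finType) (r : nat) (c : V -> V -> 'I_r) (e : rel V)
    (S : {set 'I_r}) (p : seq V) :
  sorted [rel x y | e x y && (c x y \in S)] p -> path_colors c p \subset S.
Proof.
move=> sp; apply/subsetP => i; rewrite inE => /mapP[[x y] xy ->] /=.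
elim: p sp xy => [|u [|v p] IHp] //= /andP[/andP[_ cuv] sp].
by rewrite /path_edges /= inE => /predU1P[[-> ->]//|]; apply: IHp.
Qed.

Theorem theorem1p6 (R : realType) (r s n : nat)
    (r_gt0 : (0 < r)%N) (s_gt0 : (0 < s)%N) (n_gt0 : (0 < n)%N)
    (s_le_r : (s <= r)%N)
    (V : finType) (card_V : #|V| = n)
    (e : rel V) (e_tournament : tournament e)
    (c : V -> V -> 'I_r) (c_coloring : edge_coloring c)
    (c_no_rainbow : no_rainbow_triangle c) :
  exists p : seq V,
    [/\ directed_path e p,
        (n%:R `^ (s%:R / r%:R) <= (size p)%:R :> R)%R
      & (#|path_colors c p| <= s)%N].
Proof.
pose P k := `[< exists p, [/\ directed_path e p, size p = k
                            & #|path_colors c p| <= s] >].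
have exP : exists k, P k.
  exists 0; apply/asboolP; exists [::]; split => //.
  by rewrite /path_colors set_nil cards0.
have ubP k : P k -> k <= #|V|.
  case/asboolP => p [/andP[_ up] <- _].
  by rewrite -(card_uniqP up) max_card.
case: (ex_maxnP exP ubP) => k /asboolP[p [dp pk cp]] k_max.
exists p; split=> //; rewrite pk.
pose eS (S : {set 'I_r}) := [rel x y | e x y && (c x y \in S)].
(* The condition on [#|S|] stands under the existential so that choice yields one [f] for all [S];
   the zero function is a default. *)
have level (S : {set 'I_r}) : exists f : V -> nat, #|S| == s ->
    (forall v, f v < k) /\ (forall x y, x != y -> eS S x y -> f x != f y).
  case: (boolP (#|S| == s)) => [/eqP cS|_]; last by exists (fun=> 0).
  have [|f f1 f2] := @gallai_roy V (eS S) k; last by exists f.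
  move=> q /andP[sq uq]; apply: k_max; apply/asboolP; exists q; split => //.
    rewrite /directed_path uq andbT.
    by apply: sub_sorted sq => x y /andP[].
  by rewrite -cS subset_leq_card // (path_colors_sub sq).
have {level}[f fP] := choice level.
have k_gt0 : 0 < k.
  have [v _] : exists v : V, v \in V by apply/card_gt0P; rewrite card_V.
  apply: k_max; apply/asboolP; exists [:: v]; split => //.
  by rewrite /path_colors set_nil cards0.
(* The type is ['I_k] in successor form, as [inord] requires; empty sets make disjointness trivial
   for [S] of other sizes. *)
pose F (S : {set 'I_r}) v : {set 'I_k.-1.+1} :=
  if #|S| == s then [set inord (f S v)] else set0.
have F_ok : multicoloring c [set: V] F.
  move=> S x y _ _ xy cxy; rewrite /F; case: ifP => [cS|_];
    last by rewrite disjoints_subset sub0set.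
  have [f_lt f_neq] := fP S cS.
  rewrite disjoints1 inE; apply/eqP => /(congr1 val).
  rewrite /= !inordK ?prednK // => /eqP; apply/negP.
  case: e_tournament => _ /(_ x y xy); case: (boolP (e x y)) => [exy _|_ eyx].
    by apply: f_neq; rewrite //= exy.
  by rewrite eq_sym; apply: f_neq; rewrite 1?eq_sym //= c_coloring cxy andbT.
have := block_bound c_coloring c_no_rainbow r_gt0 s_gt0 s_le_r R
  (w := fun=> 1) F_ok.
rewrite sum1_card cardsT card_V => main.
have {main}main : n ^ 'C(r.-1, s.-1) <= k ^ 'C(r, s).
  apply: leq_trans (main _) _ => [v _|].
    by rewrite exp1n big1 // => S cS; rewrite /F cS cards1.
  have -> : 'C(r, s) = #|[set S : {set 'I_r} | #|S| == s]|.
    by rewrite card_draws card_ord.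
  rewrite -prod_nat_const.
  rewrite [leqRHS](eq_bigl (fun S : {set 'I_r} => #|S| == s));
    last by move=> S; rewrite inE.
  apply: leq_prod => S _; apply: leq_trans (max_card _) _.
  by rewrite card_ord prednK.
have B_gt0 : 0 < 'C(r, s) by rewrite bin_gt0.
(* The identity [r * 'C(r.-1, s.-1) = s * 'C(r, s)] turns the exponent [s / r] into the quotient of
   the two exponents in [main]. *)
have binE := mul_bin_diag r s.-1; rewrite prednK // in binE.
have rR : (r%:R != 0 :> R)%R by rewrite pnatr_eq0 -lt0n.
have BR : ('C(r, s)%:R != 0 :> R)%R by rewrite pnatr_eq0 -lt0n.
have -> : (s%:R / r%:R = 'C(r.-1, s.-1)%:R * 'C(r, s)%:R^-1 :> R)%R.
  by apply/eqP; rewrite eqr_div // -!natrM -binE mulnC.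
rewrite powRrM powR_mulrn //.
apply: le_trans (_ : _ <= (k%:R ^+ 'C(r, s)) `^ 'C(r, s)%:R^-1)%R _.
  by apply: ge0_ler_powR; rewrite ?invr_ge0 ?nnegrE -?natrX ?ler_nat.
by rewrite -powR_mulrn // -powRrM divff // powRr1.
Qed.
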